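(* Let $X$, $Y$ be real Hilbert spaces, $K\subset X$, $\widetilde K\subset X$, $A:X\to X$, $G:X\to X$, $j:X\times X\to\mathbb{R}$, $\pi:X\to Y$, $f\in Y$, and let $\{\lambda_n\}_{n\in\mathbb{N}}\subset\mathbb{R}$, $\{f_n\}_{n\in\mathbb{N}}\subset Y$. Assume: (1) $K$ and $\widetilde K$ are nonempty, closed, convex subsets of $X$ and $K\subset\widetilde K$. (2) There exist $m>0$, $M>0$ such that $(Au-Av,u-v)_X\ge m\|u-v\|_X^2$ and $\|Au-Av\|_X\le M\|u-v\|_X$ for all $u,v\in X$. (3) For all $\eta\in X$, $j(\eta,\cdot):X\to\mathbb{R}$ is convex and lower semicontinuous, and there exists $\alpha\ge0$ such that $j(\eta_1,v_2)-j(\eta_1,v_1)+j(\eta_2,v_1)-j(\eta_2,v_2)\le\alpha\|\eta_1-\eta_2\|_X\|v_1-v_2\|_X$ for all $\eta_1,\eta_2,v_1,v_2\in X$. (4) There exist $\beta,\gamma\ge0$ such that $j(\eta,v_1)-j(\eta,v_2)\le(\beta+\gamma\|\eta\|_X)\|v_1-v_2\|_X$ for all $\eta,v_1,v_2\in X$. (5) $m>\alpha$ and $m>\gamma$. (6) For any sequences $\{\eta_n\},\{u_n\}\subset X$ with $\eta_n\rightharpoonup\eta$ and $u_n\rightharpoonup u$ in $X$, one has $\limsup\,(j(\eta_n,v)-j(\eta_n,u_n))\le j(\eta,v)-j(\eta,u)$ for all $v\in X$. (7) $\pi$ is linear and continuous, i.e. there exists $c_0>0$ with $\|\pi v\|_Y\le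 c_0\|v\|_X$ for all $v\in X$; and for any sequence $\{v_n\}\subset X$ with $v_n\rightharpoonup v$ in $X$ one has $\pi v_n\to\pi v$ in $Y$. (8) $G$ is monotone and Lipschitz continuous. (9) $(Gu,v-u)_X\le0$ for all $u\in\widetilde K$, $v\in K$; and if $u\in\widetilde K$ satisfies $(Gu,v-u)_X=0$ for all $v\in K$, then $u\in K$. (10) $\lambda_n>0$ for all $n\in\mathbb{N}$, $\lambda_n\to0$, and $f_n\rightharpoonup f$ in $Y$ as $n\to\infty$. For each $n\in\mathbb{N}$ let $u_n$ denote the solution of Problem $\mathcal{P}_n$. Then $u_n\to u$ in $X$ as $n\to\infty$, where $u$ is the solution of Problem $\mathcal{P}$.
   Context: The symbols $\rightharpoonup$ and $\to$ denote weak and strong convergence, respectively; limits are taken as $n\to\infty$. Problem $\mathcal{P}$: find $u$ such that $u\in K$ and $(Au,v-u)_X+j(u,v)-j(u,u)\ge(f,\pi v-\pi u)_Y$ for all $v\in K$. Problem $\mathcal{P}_n$: find $u_n$ such that $u_n\in\widetilde K$ and $(Au_n,v-u_n)_X+\frac{1}{\lambda_n}(Gu_n,v-u_n)_X+j(u_n,v)-j(u_n,u_n)\ge(f_n,\pi v-\pi u_n)_Y$ for all $v\in\widetilde K$. Under the stated assumptions each of Problems $\mathcal{P}$ and $\mathcal{P}_n$ has a unique solution. *)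

(* Defs.v *)
From HB Require Import structures.
From mathcomp Require Import all_boot all_order all_algebra.
From mathcomp Require Import interval_inference.
From mathcomp Require Import boolp classical_sets reals ereal convex topology
  normedtype sequences.

Set Implicit Arguments.
Unset Strict Implicit.
Unset Printing Implicit Defensive.

Import Order.TTheory GRing.Theory Num.Theory.
Import numFieldNormedType.Exports.

Local Open Scope classical_set_scope.
Local Open Scope ring_scope.

(* A real Hilbert space is rendered as a complete normed module whose norm is
   induced by an inner product (a symmetric positive definite bilinear form). *)
Definition norm_induced_by (R : realType) (X : completeNormedModType R)
    (ip : {dot X for idfun}) : Prop :=
  forall x : X, `|x| = Num.sqrt (ip x x).

(* The functionals phi range over the topological dual of X. *)
Definition weak_cvg (R : realType) (X : normedModType R)
    (u_ : nat -> X) (u : X) : Prop :=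
  forall phi : {scalar X}, continuous phi ->
    phi (u_ n) @[n --> \oo] --> phi u.

Definition monotone_op (R : realType) (X : completeNormedModType R)
    (ip : {dot X for idfun}) (T : X -> X) : Prop :=
  forall u v : X, 0 <= ip (T u - T v) (u - v).

Definition solves_P (R : realType) (X Y : completeNormedModType R)
    (ipX : {dot X for idfun}) (ipY : {dot Y for idfun})
    (K : set X) (A : X -> X) (j : X -> X -> R) (pi : X -> Y) (f : Y)
    (u : X) : Prop :=
  K u /\
  forall v, K v ->
    ipX (A u) (v - u) + j u v - j u u >= ipY f (pi v - pi u).

Definition solves_P_pen (R : realType) (X Y : completeNormedModType R)
    (ipX : {dot X for idfun}) (ipY : {dot Y for idfun})
    (Kt : set X) (A G : X -> X) (lambda : R) (j : X -> X -> R) (pi : X -> Y)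
    (f : Y) (u : X) : Prop :=
  Kt u /\
  forall v, Kt v ->
    ipX (A u) (v - u) + lambda^-1 * ipX (G u) (v - u) + j u v - j u u
      >= ipY f (pi v - pi u).

(* Main.v *)
Require Import Defs.
From HB Require Import structures.
From mathcomp Require Import all_boot all_order all_algebra.
From mathcomp Require Import interval_inference.
From mathcomp Require Import boolp classical_sets reals ereal convex topology
  normedtype sequences.
From mathcomp Require Import ring lra.

Set Implicit Arguments.
Unset Strict Implicit.
Unset Printing Implicit Defensive.

Import Order.TTheory GRing.Theory Num.Theory.
Import numFieldNormedType.Exports.

Local Open Scope classical_set_scope.
Local Open Scope ring_scope.

(** Each solution [u_ n] of the penalized problem is compared with the solution
[u] of the limit problem. Testing the [n]-th inequality with a point [v] of [K],
where the penalty term has a favourable sign, and using the strong monotonicity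
of [A] gives the energy estimate ([penalized_energy])

  m |u_n - v|^2 <= (A v, v - u_n) + j(u_n, v) - j(u_n, u_n)
                   - (f_n, pi v - pi u_n).

Three consequences of the inequality drive the proof.

- Boundedness. The sequence [f_] is bounded by Banach-Steinhaus, and since
  [gamma < m] the quadratic left-hand side absorbs the growth of [j]: the
  sequence [u_] is bounded, hence any subsequence has a further subsequence that
  converges weakly, say to [p].

- The weak limit lies in [K]. Multiplied by [lambda n], the inequality says that
  (G v, u_n - v) is at most a constant times [lambda n] for every [v] in [Kt],
  so (G v, p - v) <= 0 for all these [v]. Minty's argument turns it into
  (G p, v - p) >= 0. For [v] in [K] the reverse inequality is a property of the
  penalty operator, and the equality for all these [v] puts [p] in [K].

- The weak limit is [u] and the convergence is strong. In the energy estimate at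
  [v := u] all terms on the right pass to the limit along the subsequence; the
  inequality satisfied by [u], tested with [p], and the assumption on [j] with
  constant [alpha] then give

    m limsup |u_n - u|^2 <= alpha |p - u|^2 <= alpha liminf |u_n - u|^2,

  the last step being the weak lower semicontinuity of the norm. As [alpha < m],
  both sides vanish: the identity [p = u] and the strong convergence come out of
  the same estimate.

Every subsequence has therefore a subsequence converging to [u], which is
convergence of the whole sequence.

The Hilbert space theory needed here (Riesz representation, weak closedness of
closed convex sets, weak sequential compactness of bounded sets) is derived from
a single minimization principle, [convex_variational]. *)

(** * Inner products *)

Lemma scalar_continuousP (R : realType) (X : normedModType R)
    (phi : {scalar X}) :
  continuous phi <-> exists c, forall x, `|phi x| <= c * `|x|.
Proof.
split=> [/(linear_bounded_continuous (phi : {linear X -> R^o}))|[c phic]].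
  move=> /linear_boundedP[c [_ hc]]; exists (c + 1) => x.
  by apply: hc; rewrite ltrDl.
apply/(linear_bounded_continuous (phi : {linear X -> R^o}))/linear_boundedP.
exists c; split; first exact: num_real.
move=> r cr x; apply: le_trans (phic x) _.
by rewrite ler_wpM2r// ltW.
Qed.

Section inner_product.
Variables (R : realType) (X : completeNormedModType R).
Variable ip : {dot X for idfun}.

Lemma ipC x y : ip x y = ip y x.
Proof. by rewrite hermC expr0 mul1r. Qed.

Lemma ipDl x y z : ip (x + y) z = ip x z + ip y z.
Proof. by rewrite linearDl. Qed.

Lemma ipDr x y z : ip z (x + y) = ip z x + ip z y.
Proof. by rewrite linearD. Qed.

Lemma ipNl x z : ip (- x) z = - ip x z.
Proof. by rewrite linearNl. Qed.

Lemma ipNr x z : ip z (- x) = - ip z x.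
Proof. by rewrite linearN. Qed.

Lemma ipZl a x z : ip (a *: x) z = a * ip x z.
Proof. by rewrite linearZl_LR. Qed.

Lemma ipZr a x z : ip z (a *: x) = a * ip z x.
Proof. by rewrite linearZ. Qed.

Lemma ip0l z : ip 0 z = 0.
Proof. by rewrite -(scale0r z) ipZl mul0r. Qed.

Definition ipE := (ipDl, ipDr, ipNl, ipNr, ipZl, ipZr).

Lemma ip_ge0 x : 0 <= ip x x.
Proof.
have [->|x0] := eqVneq x 0; first by rewrite ip0l.
exact/ltW/neq0_dnorm_gt0.
Qed.

Hypothesis hilbert : norm_induced_by ip.

Lemma sqr_normE x : `|x| ^+ 2 = ip x x.
Proof. by rewrite hilbert sqr_sqrtr// ip_ge0. Qed.

Lemma ip_cauchy_schwarz x y : `|ip x y| <= `|x| * `|y|.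
Proof.
have [->|y0] := eqVneq y 0; first by rewrite ipC ip0l !normr0 mulr0.
have yy : 0 < ip y y by exact: neq0_dnorm_gt0.
(* [y]-component of [x] removed, scaled by [ip y y] to avoid a division *)
have := ip_ge0 (ip y y *: x - ip x y *: y).
rewrite !ipE (ipC y x) => h.
have {}h : 0 <= ip y y * (ip x x * ip y y - ip x y ^+ 2).
  by apply: le_trans h _; rewrite le_eqVlt; apply/orP; left; apply/eqP; ring.
rewrite -(@ler_pXn2r _ 2) ?nnegrE ?mulr_ge0// real_normK ?num_real//.
by rewrite exprMn !sqr_normE -subr_ge0; rewrite pmulr_rge0 in h.
Qed.

Lemma ip_ler x y : ip x y <= `|x| * `|y|.
Proof. exact: le_trans (ler_norm _) (ip_cauchy_schwarz x y). Qed.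

Lemma ip_continuous y : continuous (ip y).
Proof.
apply/(@scalar_continuousP _ _ (ip y)); exists `|y| => x.
exact: ip_cauchy_schwarz.
Qed.

Lemma weak_cvg_ip w p y : weak_cvg w p -> ip y (w n) @[n --> \oo] --> ip y p.
Proof. by move=> /(_ (ip y) (@ip_continuous y)). Qed.

End inner_product.

(** * Convex minimization and its consequences *)

Lemma convex_segment (R : realType) (X : completeNormedModType R) (C : set X)
    (a b : X) (t : R) :
  @convex_set R X C -> C a -> C b -> 0 <= t <= 1 -> C (a + t *: (b - a)).
Proof.
move=> cvxC Ca Cb t01.
have -> : a + t *: (b - a) = t *: b + (1 - t) *: a.
  by rewrite scalerBr scalerBl scale1r addrCA addrA addrAC.
have /andP[t0 t1] := t01.
have := cvxC b a (Itv01 t0 t1); rewrite !inE => /(_ Cb Ca).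
by [].
Qed.

Lemma affine_near0_ge0 (R : realType) (a b : R) :
  (forall t, 0 < t -> t <= 1 -> 0 <= a * t + b) -> 0 <= b.
Proof.
move=> h; apply/ler_addgt0Pr => e e0.
have k0 : 0 < 1 + `|a| by rewrite ltr_wpDr.
set t := Num.min 1 (e / (1 + `|a|)).
have t0 : 0 < t by rewrite lt_min ltr01 divr_gt0.
have t1 : t <= 1 by rewrite ge_min lexx.
have te : t * (1 + `|a|) <= e by rewrite -ler_pdivlMr// ge_min lexx orbT.
have := h t t0 t1.
have : a * t <= `|a| * t by rewrite ler_wpM2r ?ler_norm// ltW.
lra.
Qed.

Section hilbert_space.
Variables (R : realType) (X : completeNormedModType R).
Variable ip : {dot X for idfun}.
Hypothesis hilbert : norm_induced_by ip.

(** The minimizer over [C] of the strictly convex functional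
|z|^2 / 2 - phi z: minimizing sequences are Cauchy by the parallelogram
identity, and the variational inequality is the first order optimality
condition. With [C := setT] this is Riesz representation, with [phi := ip x] it
is the projection of [x] onto [C]. *)
Lemma convex_variational (C : set X) (phi : {scalar X}) :
  continuous phi ->
  C !=set0 -> closed C -> @convex_set R X C ->
  exists2 s, C s & forall z, C z -> phi (z - s) <= ip s (z - s).
Proof.
move=> phi_cont [z0 Cz0] clC cvxC.
have [c phic] := (scalar_continuousP phi).1 phi_cont.
have phiD x y : phi (x + y) = phi x + phi y by rewrite linearD.
have phiN x : phi (- x) = - phi x by rewrite linearN.
have phiZ a x : phi (a *: x) = a * phi x by rewrite linearZ.
pose phiE := (phiD, phiN, phiZ).
pose J z := ip z z - 2 * phi z.
have Jlb z : - c ^+ 2 <= J z.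
  rewrite /J -(sqr_normE hilbert).
  have := phic z => /(le_trans (ler_norm _)) h.
  have := sqr_ge0 (`|z| - c); rewrite sqrrB; lra.
have J0 : (J @` C) !=set0 by exists (J z0); exists z0.
have Jb : has_lbound (J @` C) by exists (- c ^+ 2) => _ [z _ <-].
set d := inf (J @` C).
have Jd z : C z -> d <= J z by move=> Cz; apply: ge_inf => //; exists z.
have Jseq n : exists z, C z /\ J z < d + n.+1%:R^-1.
  have [_ [z Cz <-] zd] : exists2 e, (J @` C) e & e < d + n.+1%:R^-1.
    by apply: inf_adherent => //; rewrite invr_gt0.
  by exists z.
have [z_ Jz_] := choice Jseq.
(* the value of [J] at the midpoint of [z_ n] and [z_ k] is at least [d] *)
have dist n k : `|z_ n - z_ k| ^+ 2 <= 2 * n.+1%:R^-1 + 2 * k.+1%:R^-1.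
  have [Cn Jn] := Jz_ n; have [Ck Jk] := Jz_ k.
  have h2 : 0 <= (2^-1 : R) <= 1 by lra.
  have := Jd _ (convex_segment cvxC Cn Ck h2).
  rewrite (sqr_normE hilbert).
  move: Jn Jk; rewrite /J !ipE !phiE (ipC _ (z_ k) (z_ n)).
  move: (n.+1%:R^-1) (k.+1%:R^-1) => i1 i2; lra.
have cz : cvg (z_ @ \oo).
  apply/cauchy_cvgP/cauchy_exP => e e0.
  have e4 : 0 < e ^+ 2 / 4 by rewrite divr_gt0// exprn_gt0.
  have [N _ HN] := near_infty_natSinv_lt (PosNum e4).
  exists (z_ N); exists N => // n /= Nn.
  rewrite -ball_normE /=.
  rewrite -(@ltr_pXn2r _ 2) ?nnegrE ?(ltW e0)//.
  apply: le_lt_trans (dist _ _) _.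
  have /= := HN _ (leqnn N); have /= := HN _ Nn.
  move: (n.+1%:R^-1) (N.+1%:R^-1) => i1 i2; lra.
pose s := lim (z_ @ \oo).
have zs : z_ n @[n --> \oo] --> s by exact: cz.
have Cs : C s.
  by apply: (closed_cvg C clC _ _ zs); apply: nearW => n; case: (Jz_ n).
have phis : phi (z_ n) @[n --> \oo] --> phi s.
  exact: cvg_comp zs (phi_cont s).
have Js : J s <= d.
  have Jzs : J (z_ n) @[n --> \oo] --> J s.
    apply: cvgB; last by apply: cvgMl_tmp.
    under eq_fun do rewrite -(sqr_normE hilbert).
    rewrite -(sqr_normE hilbert).
    by apply: cvgM; apply: cvg_norm.
  apply/ler_addgt0Pr => e e0.
  apply: (cvgr_to_le Jzs).
  have := near_infty_natSinv_lt (PosNum e0).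
  apply: filterS => n /= ne; have [_ Jn] := Jz_ n.
  by move: (n.+1%:R^-1) ne Jn => i; lra.
exists s => // z Cz.
rewrite -subr_ge0.
apply: (@affine_near0_ge0 _ (ip (z - s) (z - s) / 2)) => t t0 t1.
have t01 : 0 <= t <= 1 by rewrite (ltW t0).
have h := le_trans Js (Jd _ (convex_segment cvxC Cs Cz t01)).
rewrite -(pmulr_rge0 _ (mulr_gt0 (@ltr0n R 2) t0)).
move: h; rewrite /J ipDl 2!ipDr !ipZl !ipZr (ipC _ (z - s) s) !phiE.
by move: (ip s s) (ip s (z - s)) (ip (z - s) (z - s)) => a b e; lra.
Qed.

Lemma riesz_representation (phi : {scalar X}) :
  continuous phi -> exists s, forall x, phi x = ip s x.
Proof.
move=> phi_cont.
have [|||s _ hs] := @convex_variational setT phi phi_cont.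
- by exists 0.
- exact: closedT.
- by move=> x y t _ _; rewrite inE.
have le x : phi x <= ip s x.
  by have := hs (s + x) Logic.I; rewrite addrAC subrr add0r.
exists s => x; apply/eqP; rewrite eq_le le /=.
by have := le (- x); rewrite linearN ipNr lerN2.
Qed.

(** * Weak convergence *)

Lemma weak_cvg_of_ip (w : nat -> X) p :
  (forall y, ip y (w n) @[n --> \oo] --> ip y p) -> weak_cvg w p.
Proof.
move=> h phi /riesz_representation[s phiE].
by rewrite phiE; under eq_fun do rewrite phiE; exact: h.
Qed.

(** The sequence stays in the half-space of the [z] with
ip (s - p) (z - s) >= 0, where [s] is the projection of [p] onto [C]. This
half-space is weakly closed and contains [p] only if [p = s]. *)
Lemma weak_cvg_closed_convex (C : set X) (w : nat -> X) p :
  closed C -> @convex_set R X C -> (forall n, C (w n)) -> weak_cvg w p -> C p.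
Proof.
move=> clC cvxC Cw wp.
have C0 : C !=set0 by exists (w 0).
have [s Cs hs] :=
  convex_variational (@ip_continuous _ _ ip hilbert p) C0 clC cvxC.
suff <- : s = p by [].
have cv : ip (s - p) (w n) @[n --> \oo] --> ip (s - p) p.
  exact: weak_cvg_ip.
have : ip (s - p) s <= ip (s - p) p.
  apply: (cvgr_to_ge cv); apply: nearW => n.
  by have := hs _ (Cw n); rewrite !ipE; lra.
rewrite -subr_le0 -ipNr -ipDr -(sqr_normE hilbert) => h.
apply/eqP; rewrite -subr_eq0 -normr_eq0 -sqrf_eq0.
by rewrite eq_le h sqr_ge0.
Qed.

(** Uniform boundedness principle for the functionals [ip (w n)]: a common bound
on the unit ball, evaluated at the normalized [w n], is a bound on the norms. *)
Lemma weak_cvg_bounded (w : nat -> X) p :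
  weak_cvg w p -> exists B, forall n, `|w n| <= B.
Proof.
move=> wp.
have [||M hM] :=
  @Banach_Steinhauss R X R^o [set f | exists n, f = ip (w n)] _ _ 1.
- move=> _ [n ->]; split; last by move=> a x y; rewrite linearP.
  move=> r; exists (`|w n| * r) => x xr.
  by apply: le_trans (ip_cauchy_schwarz hilbert _ _) _; rewrite ler_wpM2l.
- move=> x.
  have /cvgP/cvg_seq_bounded[M [_ hM]] := weak_cvg_ip hilbert (y := x) wp.
  exists (M + 1) => _ [n ->]; rewrite ipC.
  by apply: (hM (M + 1)) => //; rewrite ltrDl.
exists M => n; have [->|wn0] := eqVneq (w n) 0.
  rewrite normr0; apply: le_trans (normr_ge0 (ip (w n) 0)) _.
  by apply: hM; [exists n|rewrite normr0].
have nw0 : 0 < `|w n| by rewrite normr_gt0.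
have := hM (ip (w n)) (ex_intro _ n erefl) (`|w n|^-1 *: w n).
rewrite normrZ normfV normr_id mulVf ?gt_eqF// ipZr.
rewrite -(sqr_normE hilbert) expr2.
by rewrite mulKf ?gt_eqF// normr_id; apply.
Qed.

Lemma ultra_bounded_cvg (T : Type) (U : set_system T) (a : T -> R) B :
  UltraFilter U -> (forall t, `|a t| <= B) ->
  exists l : R, a t @[t --> U] --> l.
Proof.
move=> UU aB.
have [|l [_ hl]] := @segment_compact R (- B) B (a t @[t --> U]) _.
  by apply: nearW => t; rewrite /= in_itv/= -ler_norml.
exists l => V Vl.
have [//|UV] := in_ultra_setVsetC (a @^-1` V) UU.
by have [y []] := hl (~` V) V UV Vl.
Qed.

(** Along an ultrafilter finer than the cofinite one, all the scalar sequences
ip y (x n) converge, and Riesz turns the limit functional into a vector [p].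
Only countably many of these limits can be tracked by one subsequence, so [e] is
chosen to follow them for [y] among the [x k]. The [y] for which the limit
persists form a closed subspace containing the [x k]; the part of [y]
orthogonal to it is orthogonal to all the [x n] and, passing to the limit along
the ultrafilter, to [p]. *)
Lemma bounded_weak_cvg_subseq (x : nat -> X) B :
  (forall n, `|x n| <= B) ->
  exists e : nat -> nat, e n @[n --> \oo] --> \oo /\
    exists p, weak_cvg (x \o e) p.
Proof.
move=> xB.
have [U [UU ooU]] := @ultraFilterLemma nat \oo _.
have ipxB y n : `|ip y (x n)| <= `|y| * B.
  by apply: le_trans (ip_cauchy_schwarz hilbert _ _) _; rewrite ler_wpM2l.
have [L L_cvg] := choice (fun y => ultra_bounded_cvg UU (ipxB y)).
have uniqU (l l' : R) : forall w : nat -> R,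
    w n @[n --> U] --> l -> w n @[n --> U] --> l' -> l = l'.
  by move=> w; apply: cvg_unique; exact: Rhausdorff.
have L_lin : linear (L : X -> R^o).
  move=> a y z; apply: uniqU (L_cvg _) _.
  under eq_fun do rewrite ipDl ipZl.
  by apply: cvgD (L_cvg z); exact: cvgMl_tmp.
pose Lin : {scalar X} :=
  HB.pack (L : X -> R^o) (GRing.isLinear.Build _ _ _ _ _ L_lin).
have L_cont : continuous Lin.
  apply/scalar_continuousP; exists B => y; rewrite mulrC.
  by apply: (cvgr_to_le (cvg_norm (L_cvg y))); exact: nearW.
have [p Lp] := riesz_representation L_cont.
have {Lp L_lin Lin L_cont}Lp y : L y = ip y p by rewrite ipC -Lp.
have near_e i : exists n, (i <= n)%N /\
    forall k, (k <= i)%N -> `|ip (x k) (x n) - ip (x k) p| < i.+1%:R^-1.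
  apply: (@filter_ex _ U); apply: filterI.
    by apply: ooU; exact: nbhs_infty_ge.
  suff : forall k : 'I_i.+1,
      U [set n | `|ip (x k) (x n) - ip (x k) p| < i.+1%:R^-1].
    move=> /filter_forall; apply: filterS => n h k ki.
    exact: (h (Ordinal (ki : (k < i.+1)%N))).
  move=> k; have := L_cvg (x k); rewrite Lp => /cvgrPdist_lt/(_ (i.+1%:R^-1)).
  rewrite invr_gt0 ltr0n => /(_ isT); apply: filterS => n.
  by rewrite distrC.
have [e he] := choice near_e.
exists e; split.
  by apply/cvgnyPge => A; exists A => // n /= An; apply: leq_trans An (he n).1.
exists p; apply: weak_cvg_of_ip => y.
pose S := [set y | ip y (x (e n)) @[n --> \oo] --> ip y p].
have S0 : S 0.
  rewrite /S/=; under eq_fun do rewrite ip0l.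
  by rewrite ip0l; exact: cvg_cst.
have Slin a v w : S v -> S w -> S (a *: v + w).
  move=> Sv Sw; rewrite /S /= ipDl ipZl.
  under eq_fun do rewrite ipDl ipZl.
  by apply: cvgD Sw; exact: cvgMl_tmp.
have Sx k : S (x k).
  apply/cvgrPdist_le => eps eps0.
  have := near_infty_natSinv_lt (PosNum eps0) => -[N _ HN].
  exists (maxn N k) => // n /=; rewrite geq_max => /andP[Nn kn].
  rewrite distrC; apply/ltW/lt_trans/(HN n Nn).
  exact: (he n).2.
have Sclosed : closed S.
  move=> v clSv; apply/cvgrPdist_le => eps eps0.
  have k0 : 0 < `|p| + B + 1.
    by rewrite ltr_wpDl// addr_ge0//; exact: le_trans (xB 0).
  have eps2 : 0 < eps / 2 by rewrite divr_gt0.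
  have [w [Sw vw]] := clSv _ (nbhsx_ballx v _ (divr_gt0 eps2 k0)).
  rewrite -ball_normE/= in vw.
  move/cvgrPdist_le : Sw => /(_ _ eps2).
  apply: filterS => n hn.
  have -> : ip v p - ip v (x (e n)) =
      ip (v - w) (p - x (e n)) + (ip w p - ip w (x (e n))).
    by rewrite !ipE; ring.
  apply: le_trans (ler_normD _ _) _; rewrite [leRHS]splitr lerD//.
  apply: le_trans (ip_cauchy_schwarz hilbert _ _) _.
  rewrite ltr_pdivlMr// in vw; apply/ltW/le_lt_trans/vw.
  rewrite ler_wpM2l//; apply: le_trans (ler_normB _ _) _.
  by rewrite -addrA lerD// ler_wpDr// xB.
have Scvx : @convex_set R X S.
  move=> v w t; rewrite !inE => Sv Sw.
  change (S (t%:num *: v + (1 - t%:num) *: w)).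
  by apply: (Slin _ _ _ Sv); rewrite -[_ *: w]addr0; exact: Slin.
(* [s] is the projection of [y] onto [S] *)
have [s Ss hs] := convex_variational (@ip_continuous _ _ ip hilbert y)
  (ex_intro _ 0 S0) Sclosed Scvx.
have orth v : S v -> ip (y - s) v = 0.
  move=> Sv; apply/eqP; rewrite eq_le; apply/andP; split.
    have := hs (s + v); rewrite addrAC subrr add0r => h.
    by rewrite ipDl ipNl subr_le0 h// -(scale1r s); exact: Slin.
  have := hs (s - v); rewrite addrAC subrr add0r => h.
  rewrite ipDl ipNl subr_ge0 -lerN2 -!ipNr h// addrC -scaleN1r; exact: Slin.
have orthp : ip (y - s) p = 0.
  rewrite -Lp; apply: uniqU (L_cvg _) _.
  by under eq_fun do rewrite orth//; exact: cvg_cst.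
have ys z : ip (y - s) z = 0 -> ip y z = ip s z.
  by rewrite ipDl ipNl => /eqP; rewrite subr_eq0 => /eqP.
rewrite (ys p)//; under eq_fun do rewrite (ys _ (orth _ (Sx _))).
exact: Ss.
Qed.
End hilbert_space.

(** * Limits along subsequences *)

Lemma cvg_of_subsequences (R : realType) (X : normedModType R)
    (w : nat -> X) (l : X) :
  (forall g : nat -> nat, g n @[n --> \oo] --> \oo ->
    exists2 e : nat -> nat, e n @[n --> \oo] --> \oo &
      w (g (e n)) @[n --> \oo] --> l) ->
  w n @[n --> \oo] --> l.
Proof.
move=> sub; apply/cvgrPdist_lt => eps eps0; apply: contrapT => nw.
have far N : exists n, (N <= n)%N /\ eps <= `|l - w n|.
  apply: contrapT => h; apply: nw; exists N => // n /= Nn.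
  by rewrite ltNge; apply/negP => hn; apply: h; exists n.
have [g hg] := choice far.
have [|e eoo /cvgrPdist_lt/(_ _ eps0)] := sub g.
  by apply/cvgnyPge => A; exists A => // n /= An; apply: leq_trans An (hg n).1.
move=> /(@filter_ex _ _ _) [n]; rewrite ltNge => /negP; apply.
exact: (hg _).2.
Qed.

Lemma limn_esup_le_near (R : realType) (a : nat -> R) (l eps : R) :
  (limn_esup (fun n => (a n)%:E) <= l%:E)%E -> 0 < eps ->
  \forall n \near \oo, a n <= l + eps.
Proof.
move=> al eps0.
have : (limn_esup (fun n => (a n)%:E) < (l + eps)%:E)%E.
  by apply: le_lt_trans al _; rewrite lte_fin ltrDl.
move=> /ereal_inf_lt[_ [V Voo <-] supV].
apply: filterS Voo => n Vn; rewrite -lee_fin; apply/ltW/le_lt_trans/supV.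
by apply: ereal_sup_ubound; exists n.
Qed.

Lemma weak_cvg_subseq (R : realType) (X : normedModType R) (w : nat -> X) p
    (e : nat -> nat) :
  e n @[n --> \oo] --> \oo -> weak_cvg w p -> weak_cvg (w \o e) p.
Proof.
by move=> eoo wp phi phic; exact: cvg_comp eoo (wp phi phic).
Qed.

(** The strong convergence of [y_] beats the mere boundedness of [f_] in
ip (f_ n) (y_ n - y). *)
Lemma ip_weak_strong_cvg (R : realType) (Y : completeNormedModType R)
    (ip : {dot Y for idfun}) (f_ y_ : nat -> Y) (f y : Y) :
  norm_induced_by ip -> weak_cvg f_ f -> y_ n @[n --> \oo] --> y ->
  ip (f_ n) (y_ n) @[n --> \oo] --> ip f y.
Proof.
move=> hilbert ff yy.
have [B fB] := weak_cvg_bounded hilbert ff.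
have -> : ip f y = 0 + ip y f by rewrite add0r ipC.
have -> : (fun n => ip (f_ n) (y_ n)) =
    (fun n => ip (f_ n) (y_ n - y) + ip y (f_ n)).
  by apply/funext => n; rewrite ipDr ipNr (ipC _ y) subrK.
apply: cvgD; last exact: weak_cvg_ip.
have By0 : B * `|y_ n - y| @[n --> \oo] --> (0 : R).
  rewrite -(mulr0 B); apply: cvgMl_tmp; rewrite -(@normr0 _ Y).
  by apply: cvg_norm; rewrite -(subrr y); apply: cvgB => //; exact: cvg_cst.
apply: norm_cvg0; apply: squeeze_cvgr By0; last exact: cvg_cst.
apply: nearW => n; rewrite normr_ge0 /=.
by apply: le_trans (ip_cauchy_schwarz hilbert _ _) _; rewrite ler_wpM2r.
Qed.

(** * Penalty method *)

(** Minty's argument: the inequality at the points [p + t *: (v - p)] of [C] is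
divided by [t], and [t] tends to 0. *)
Lemma minty (R : realType) (X : completeNormedModType R)
    (ip : {dot X for idfun}) (C : set X) (G : X -> X) (p : X) :
  norm_induced_by ip -> @convex_set R X C -> lipschitz G -> C p ->
  (forall v, C v -> ip (G v) (p - v) <= 0) ->
  forall v, C v -> 0 <= ip (G p) (v - p).
Proof.
move=> hilbert cvxC [L [_ hL]] Cp weak v Cv.
have GL x y : `|G x - G y| <= (L + 1) * `|x - y|.
  by have := hL (L + 1); rewrite ltrDl => /(_ ltr01 (x, y)); apply.
apply: (@affine_near0_ge0 _ ((L + 1) * `|v - p| ^+ 2)) => t t0 t1.
have t01 : 0 <= t <= 1 by rewrite (ltW t0).
set w := p + t *: (v - p).
have := weak _ (convex_segment cvxC Cp Cv t01); rewrite -/w.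
have -> : p - w = - (t *: (v - p)) by rewrite /w opprD addrA subrr add0r.
rewrite ipNr ipZr oppr_le0 pmulr_rge0// => Gw.
have := ip_ler hilbert (G w - G p) (v - p).
have := GL w p.
have -> : w - p = t *: (v - p) by rewrite /w addrAC subrr add0r.
rewrite normrZ gtr0_norm// => h1 h2.
have := le_trans h2 (ler_wpM2r (normr_ge0 _) h1).
by rewrite ipDl ipNl; lra.
Qed.

Section penalty.
Variables (R : realType) (X Y : completeNormedModType R).
Variables (ipX : {dot X for idfun}) (ipY : {dot Y for idfun}).
Hypotheses (hilbertX : norm_induced_by ipX) (hilbertY : norm_induced_by ipY).
Variables (K Kt : set X) (A G : X -> X) (j : X -> X -> R).
Variable pi : {linear X -> Y}.
Variables (m beta gamma c0 : R).
Hypotheses (m_ge0 : 0 <= m) (beta_ge0 : 0 <= beta) (gamma_ge0 : 0 <= gamma).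
Hypothesis c0_ge0 : 0 <= c0.
Hypothesis K_sub_Kt : K `<=` Kt.
Hypothesis A_strongly_monotone : forall u v : X,
  ipX (A u - A v) (u - v) >= m * `|u - v| ^+ 2.
Hypothesis j_beta_gamma : forall eta v1 v2 : X,
  j eta v1 - j eta v2 <= (beta + gamma * `|eta|) * `|v1 - v2|.
Hypothesis pi_bounded : forall v : X, `|pi v| <= c0 * `|v|.

Hypothesis G_le0 : forall u v : X, Kt u -> K v -> ipX (G u) (v - u) <= 0.

Lemma source_le f F v w : `|f| <= F ->
  - ipY f (pi v - pi w) <= F * c0 * `|v - w|.
Proof.
move=> fF; rewrite -ipNr -linearB -linearN.
apply: le_trans (ip_ler hilbertY _ _) _.
apply: le_trans (ler_wpM2r (normr_ge0 _) fF) _.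
rewrite -mulrA ler_wpM2l//; first exact: le_trans fF.
by apply: le_trans (pi_bounded _) _; rewrite normrN.
Qed.

(** The penalty term is nonpositive at a test point of [K], so it can be dropped
whatever the size of [lambda]. *)
Lemma penalized_energy lambda f w v :
  0 < lambda ->
  solves_P_pen ipX ipY Kt A G lambda j pi f w -> K v ->
  m * `|w - v| ^+ 2 <=
    ipX (A v) (v - w) + (j w v - j w w) - ipY f (pi v - pi w).
Proof.
move=> l0 [Ktw sol] Kv.
have := sol _ (K_sub_Kt Kv).
have : lambda^-1 * ipX (G w) (v - w) <= 0.
  by rewrite pmulr_rle0 ?invr_gt0//; exact: G_le0.
have := A_strongly_monotone w v.
rewrite -(opprB w v) ipDl !ipNl !ipNr.
lra.
Qed.

Lemma energy_bound f F w v : `|f| <= F ->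
  m * `|w - v| ^+ 2 <=
    ipX (A v) (v - w) + (j w v - j w w) - ipY f (pi v - pi w) ->
  gamma < m ->
  `|w - v| <= (`|A v| + beta + gamma * `|v| + F * c0) / (m - gamma).
Proof.
move=> fF le gm.
rewrite ler_pdivlMr ?subr_gt0//.
have [->|wv0] := eqVneq w v.
  rewrite subrr normr0 mul0r; have F0 : 0 <= F by exact: le_trans fF.
  by rewrite !addr_ge0// mulr_ge0.
have r0 : 0 < `|w - v| by rewrite normr_gt0 subr_eq0.
rewrite -(ler_pM2l r0).
have h1 := ip_ler hilbertX (A v) (v - w).
have h2 := j_beta_gamma w v w.
have h3 := source_le v w fF.
have h4 : `|w| <= `|w - v| + `|v| by rewrite -{1}(subrK v w) ler_normD.
have h5 := ler_wpM2r (ltW r0) (ler_wpM2l gamma_ge0 h4).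
rewrite (distrC v w) in h1 h2 h3.
nra.
Qed.

(** Multiplying the inequality by [lambda] leaves a quantity of order [lambda];
by monotonicity, [G w] may be replaced by [G v], after which the left-hand side
is weakly continuous in [w]. *)
Lemma penalty_term_bound lambda f F B w v :
  monotone_op ipX G -> 0 < lambda -> `|f| <= F -> `|w| <= B ->
  solves_P_pen ipX ipY Kt A G lambda j pi f w -> Kt v ->
  ipX (G v) (w - v) <=
    lambda * ((`|A v| + beta + gamma * B + F * c0) * (B + `|v|)).
Proof.
move=> G_mono l0 fF wB [_ sol] Ktv.
have F0 : 0 <= F by exact: le_trans fF.
have B0 : 0 <= B by exact: le_trans wB.
have Gvw : ipX (G v) (w - v) <= ipX (G w) (w - v).
  by rewrite -subr_ge0 -ipNl -ipDl; exact: G_mono.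
apply: le_trans Gvw _; rewrite -ler_pdivrMl//.
have hs := sol _ Ktv.
have hA : 0 <= ipX (A w - A v) (w - v).
  by apply: le_trans (A_strongly_monotone w v); rewrite mulr_ge0// exprn_ge0.
have h1 := ip_ler hilbertX (A v) (v - w).
have h2 := j_beta_gamma w v w.
have h3 := source_le v w fF.
have h4 : `|v - w| <= B + `|v|.
  by apply: le_trans (ler_normB _ _) _; rewrite addrC lerD.
have h5 : (beta + gamma * `|w|) * `|v - w| <= (beta + gamma * B) * `|v - w|.
  by rewrite ler_wpM2r// lerD// ler_wpM2l.
have : (`|A v| + beta + gamma * B + F * c0) * `|v - w| <=
    (`|A v| + beta + gamma * B + F * c0) * (B + `|v|).
  by rewrite ler_wpM2l// !addr_ge0// mulr_ge0.
apply: le_trans.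
move: hs hA; rewrite -(opprB w v) ipDl !ipNl !ipNr (opprB w v); lra.
Qed.

Lemma penalized_weak_limit_in (lambda : nat -> R) (f_ : nat -> Y) f
    (w : nat -> X) p :
  closed Kt -> @convex_set R X Kt ->
  monotone_op ipX G -> lipschitz G ->
  (forall u : X, Kt u ->
     (forall v : X, K v -> ipX (G u) (v - u) = 0) -> K u) ->
  (forall n, 0 < lambda n) -> lambda n @[n --> \oo] --> (0 : R) ->
  weak_cvg f_ f ->
  (forall n, solves_P_pen ipX ipY Kt A G (lambda n) j pi (f_ n) (w n)) ->
  weak_cvg w p -> K p.
Proof.
move=> clKt cvxKt G_mono G_lip G_eq0 l0 l_cvg f_cvg w_sol wp.
have [F fF] := weak_cvg_bounded hilbertY f_cvg.
have [B wB] := weak_cvg_bounded hilbertX wp.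
have Ktp : Kt p.
  apply: (weak_cvg_closed_convex hilbertX clKt cvxKt _ wp) => n.
  by case: (w_sol n).
have weak v : Kt v -> ipX (G v) (p - v) <= 0.
  move=> Ktv.
  set C := (`|A v| + beta + gamma * B + F * c0) * (B + `|v|).
  have lC : lambda n * C @[n --> \oo] --> (0 : R).
    by rewrite -(mul0r C); exact: cvgMr_tmp.
  have Gw : ipX (G v) (w n - v) @[n --> \oo] --> ipX (G v) (p - v).
    under eq_fun do rewrite ipDr.
    rewrite ipDr; apply: cvgD; last exact: cvg_cst.
    exact: weak_cvg_ip.
  apply: (ler_cvg_to Gw lC); apply: nearW => n.
  exact: penalty_term_bound (fF n) (wB n) (w_sol n) Ktv.
apply: G_eq0 => // v Kv; apply/eqP; rewrite eq_le G_le0//=.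
by apply: (minty hilbertX cvxKt) => //; exact: K_sub_Kt.
Qed.

End penalty.

Theorem theorem4 (R : realType) (X Y : completeNormedModType R)
  (ipX : {dot X for idfun}) (ipY : {dot Y for idfun})
  (hilbertX : norm_induced_by ipX) (hilbertY : norm_induced_by ipY)
  (K Kt : set X) (A G : X -> X) (j : X -> X -> R) (pi : {linear X -> Y})
  (f : Y) (lambda : nat -> R) (f_ : nat -> Y)
  (m M alpha beta gamma c0 : R)
  (* (1) *)
  (K_neq0 : K !=set0) (K_closed : closed K) (K_convex : @convex_set R X K)
  (Kt_neq0 : Kt !=set0) (Kt_closed : closed Kt) (Kt_convex : @convex_set R X Kt)
  (K_sub_Kt : K `<=` Kt)
  (* (2) *)
  (m_gt0 : 0 < m) (M_gt0 : 0 < M)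
  (A_strongly_monotone : forall u v : X,
     ipX (A u - A v) (u - v) >= m * `|u - v| ^+ 2)
  (A_lipschitz : forall u v : X, `|A u - A v| <= M * `|u - v|)
  (* (3) *)
  (j_convex : forall eta : X, @convex_function R X setT (j eta))
  (j_lsc : forall eta : X, lower_semicontinuous (fun v : X => (j eta v)%:E))
  (alpha_ge0 : 0 <= alpha)
  (j_alpha : forall eta1 eta2 v1 v2 : X,
     j eta1 v2 - j eta1 v1 + j eta2 v1 - j eta2 v2
       <= alpha * `|eta1 - eta2| * `|v1 - v2|)
  (* (4) *)
  (beta_ge0 : 0 <= beta) (gamma_ge0 : 0 <= gamma)
  (j_beta_gamma : forall eta v1 v2 : X,
     j eta v1 - j eta v2 <= (beta + gamma * `|eta|) * `|v1 - v2|)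
  (* (5) *)
  (alpha_lt_m : alpha < m) (gamma_lt_m : gamma < m)
  (* (6) *)
  (j_limsup : forall (eta_ u_ : nat -> X) (eta u : X),
     weak_cvg eta_ eta -> weak_cvg u_ u -> forall v : X,
     (limn_esup (fun n => (j (eta_ n) v - j (eta_ n) (u_ n))%:E)
       <= (j eta v - j eta u)%:E)%E)
  (* (7) *)
  (c0_gt0 : 0 < c0) (pi_bounded : forall v : X, `|pi v| <= c0 * `|v|)
  (pi_compact : forall (v_ : nat -> X) (v : X),
     weak_cvg v_ v -> pi (v_ n) @[n --> \oo] --> pi v)
  (* (8) *)
  (G_monotone : monotone_op ipX G) (G_lipschitz : lipschitz G)
  (* (9) *)
  (G_le0 : forall u v : X, Kt u -> K v -> ipX (G u) (v - u) <= 0)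
  (G_eq0 : forall u : X, Kt u ->
     (forall v : X, K v -> ipX (G u) (v - u) = 0) -> K u)
  (* (10) *)
  (lambda_gt0 : forall n, 0 < lambda n)
  (lambda_cvg : lambda n @[n --> \oo] --> (0 : R))
  (f_cvg : weak_cvg f_ f)
  (u_ : nat -> X)
  (u_sol : forall n,
     solves_P_pen ipX ipY Kt A G (lambda n) j pi (f_ n) (u_ n))
  (u : X) (u_sol_P : solves_P ipX ipY K A j pi f u) :
  u_ n @[n --> \oo] --> u.
Proof.
have c0_ge0 := ltW c0_gt0; have m_ge0 := ltW m_gt0.
have [Ku u_le] := u_sol_P.
have [F fF] := weak_cvg_bounded hilbertY f_cvg.
have energy n : m * `|u_ n - u| ^+ 2 <=
    ipX (A u) (u - u_ n) + (j (u_ n) u - j (u_ n) (u_ n))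
      - ipY (f_ n) (pi u - pi (u_ n)).
  exact: penalized_energy (u_sol n) Ku.
have [B uB] : exists B, forall n, `|u_ n| <= B.
  exists ((`|A u| + beta + gamma * `|u| + F * c0) / (m - gamma) + `|u|) => n.
  rewrite -{1}(subrK u (u_ n)); apply: le_trans (ler_normD _ _) _.
  by rewrite lerD2r; apply: energy_bound (energy n) _.
apply: cvg_of_subsequences => g g_oo.
have [e [e_oo [p wp]]] := bounded_weak_cvg_subseq hilbertX (fun n => uB (g n)).
exists e => //.
have ge_oo : g (e n) @[n --> \oo] --> \oo by exact: cvg_comp e_oo g_oo.
pose w n := u_ (g (e n)).
have fp : weak_cvg (fun n => f_ (g (e n))) f.
  exact: weak_cvg_subseq ge_oo f_cvg.
have Kp : K p.
  apply: (@penalized_weak_limit_in _ X Y _ _ hilbertX hilbertY K Kt A G j pi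
    m beta gamma c0 _ _ _ _ _ _ _ _ _ (lambda \o (g \o e)) (f_ \o (g \o e))
    f w) => //.
  - by move=> n; exact: lambda_gt0.
  - exact: cvg_comp ge_oo lambda_cvg.
  - by move=> n; exact: u_sol.
(* energy estimate at [u] combined with the inequality for [u] tested at [p] *)
have upper eps : 0 < eps -> \forall n \near \oo,
    m * `|w n - u| ^+ 2 <= alpha * `|u - p| ^+ 2 + eps.
  move=> eps0.
  have e3 : 0 < eps / 3 by rewrite divr_gt0.
  have cA : ipX (A u) (u - w n) @[n --> \oo] --> ipX (A u) (u - p).
    under eq_fun do rewrite ipDr ipNr.
    by rewrite ipDr ipNr; apply: cvgB; [exact: cvg_cst|exact: weak_cvg_ip].
  have cf : ipY (f_ (g (e n))) (pi u - pi (w n)) @[n --> \oo] -->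
      ipY f (pi u - pi p).
    apply: ip_weak_strong_cvg => //.
    by apply: cvgB; [exact: cvg_cst|exact: pi_compact].
  have /cvgrPdist_le/(_ _ e3) nA := cA.
  have /cvgrPdist_le/(_ _ e3) nf := cf.
  have nj := limn_esup_le_near (j_limsup _ _ _ _ wp wp u) e3.
  near=> n.
  have en := energy (g (e n)).
  have hA : `|ipX (A u) (u - p) - ipX (A u) (u - w n)| <= eps / 3 by near: n.
  have hf : `|ipY f (pi u - pi p) - ipY (f_ (g (e n))) (pi u - pi (w n))|
    <= eps / 3 by near: n.
  have hj : j (w n) u - j (w n) (w n) <= j p u - j p p + eps / 3 by near: n.
  have := u_le _ Kp; have := j_alpha u p u p.
  move: en hA hf hj; rewrite -/(w n) -mulrA -expr2 !ler_norml.
  rewrite -(opprB u p) -(opprB (pi u)) !ipNr.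
  move=> en /andP[hA1 hA2] /andP[hf1 hf2]; lra.
(* weak lower semicontinuity of the norm *)
have lower eps : 0 < eps -> \forall n \near \oo,
    `|u - p| ^+ 2 - eps <= `|w n - u| ^+ 2.
  move=> eps0; have e2 : 0 < eps / 2 by rewrite divr_gt0.
  have /cvgrPdist_le/(_ _ e2) := weak_cvg_ip hilbertX (y := p - u) wp.
  apply: filterS => n; rewrite -/(w n) -ipNr -ipDr ler_norml => /andP[_ h].
  have := ip_ge0 ipX (w n - p); rewrite distrC !(sqr_normE hilbertX).
  have -> : w n - u = (p - u) - (p - w n).
    by rewrite opprB [RHS]addrC addrA subrK.
  rewrite -(opprB p (w n)); move: h; move: (p - u) (p - w n) => a b.
  by rewrite !ipE (ipC _ b a); lra.
have up : u = p.
  apply/eqP; rewrite -subr_eq0 -normr_eq0 -sqrf_eq0 eq_le sqr_ge0 andbT.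
  rewrite -(pmulr_rle0 _ (_ : 0 < m - alpha)) ?subr_gt0//.
  apply/ler_addgt0Pr => eps eps0.
  have e2 : 0 < eps / 2 by rewrite divr_gt0.
  have e3 : 0 < eps / 2 / m by rewrite divr_gt0.
  have [n [h1 h2]] := filter_ex (filterI (upper _ e2) (lower _ e3)).
  have := ler_wpM2l m_ge0 h2; rewrite mulrBr [m * (_ / m)]mulrC divfK ?gt_eqF//.
  lra.
apply/cvgrPdist_le => eps eps0.
have em : 0 < m * eps ^+ 2 by rewrite mulr_gt0// exprn_gt0.
have := upper _ em; apply: filterS => n.
rewrite up subrr normr0 expr0n mulr0 add0r ler_pM2l// distrC.
by rewrite ler_pXn2r ?nnegrE// ltW.
Unshelve. all: by end_near. Qed.
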